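(* For every composition $\alpha$, the augmented quasicrystal skeleton $\mathsf{QCS}^+_\alpha$ is connected (as a graph, ignoring orientations of edges).
   Context: Diagrams are in French notation: rows are numbered from bottom to top, columns from left to right. The diagram of a composition $\alpha$ has $\alpha_r$ left-justified cells in row $r$. $\mathsf{SYT}(\lambda)$ is the set of standard Young tableaux of partition shape $\lambda$, $n=|\lambda|$. $[a,b]=\{a,\ldots,b\}$. $\mathsf{row}(T)$ is the row reading word: rows read from top to bottom, each from left to right. For a word $\pi$ and interval $J$, $\pi|_J$ is the subword of letters in $J$. Dyck pattern interval: with $\pi=\mathsf{row}(T)$, an interval $I=[i,i+2m]\subseteq[1,n]$, $m\geqslant1$, is a Dyck pattern interval of $T$ if the RSK insertion tableaux of $\pi|_I$ and $\pi|_{[i,i+m]}$ have shapes $(m+1,m)$ and $(m+1)$. Associate to each letter of $[i+m+1,i+2m]$ in $\pi|_I$ an open bracket and to each letter of $[i,i+m]$ a closed bracket; exactly one closed bracket is unpaired; let $k\in[i,i+m]$ be its letter. $I\cdot T$ is obtained from $T$ by replacing the entry $k$ by $k+m$ and each entry $x$ with $k<x\leqslant k+m$ by $x-1$. Crystal skeleton $\mathsf{CS}(\lambda)$: directed graph on $\mathsf{SYT}(\lambda)$ with an edge $T\to I\cdot T$ for every Dyck pattern interval $I$ of $T$. Standard Young composition tableau of shape $\alpha$ ($|\alpha|=n$): a bijective filling $\widehat T$ of the diagram of $\alpha$ with $1,\ldots,n$ such that (1) rows increase from left to right; (2) the leftmost column increases from bottom to top; (3) if $r'>r$, $(r,c+1)$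 is in the diagram, and $\widehat T(r,c+1)\geqslant \widehat T(r',c)$, then $\widehat T(r,c+1)>\widehat T(r',c+1)$, where empty cells are considered to contain $\infty$. The map $\varphi$ from standard Young composition tableaux of shapes rearranging $\lambda$ to $\mathsf{SYT}(\lambda)$, which sorts each column in increasing order from bottom to top, is a bijection. Its inverse $\varphi^{-1}$: write the leftmost column of $T$ increasing bottom to top; then, column by column from left to right, place the entries of each column of $T$ from smallest to largest, each into the highest unoccupied cell of that column whose left neighbor is smaller. Quasicrystal skeleton $\mathsf{QCS}_\alpha$: for $\alpha$ a rearrangement of the partition $\lambda$, the induced subgraph of $\mathsf{CS}(\lambda)$ on all $T$ such that $\varphi^{-1}(T)$ has shape $\alpha$. Its vertices may equivalently be labeled by the standard Young composition tableaux $\widehat T=\varphi^{-1}(T)$ of shape $\alpha$. Operators $t_i$: if $i$ and $i+1$ are entries of a standard Young composition tableau $\widehat T$ whose columns differ by more than $1$ in absolute value, and $i+1$ is in a higher row than $i$, then $t_i(\widehat T)$ is the standard Young composition tableau obtained by swapping the entries $i$ and $i+1$. Augmented quasicrystal skeleton $\mathsf{QCS}^+_\alpha$: the graph $\mathsf{QCS}_\alpha$ together with all edges $\widehat T\stackrel{t_i}{\longrightarrow}t_i(\widehat T)$ for $\widehat T\in\mathsf{QCS}_\alpha$ (whenever $t_i(\widehat T)$ is defined). *)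

(* Defs.v *)
From Stdlib Require Export Relation_Operators.
From mathcomp Require Export all_boot.

Set Implicit Arguments.
Unset Strict Implicit.
Unset Printing Implicit Defensive.

(* French notation: a tableau is the list of its rows from bottom to top, each
   row from left to right.  Rows and columns are indexed from 0, so the library's
   [shape T] is the composition whose diagram T fills. *)
Definition tableau := seq (seq nat).

Definition row (T : tableau) (r : nat) : seq nat := nth [::] T r.

Definition in_diagram (T : tableau) (r c : nat) : bool := c < size (row T r).

(* Only meaningful when [in_diagram T r c]. *)
Definition entry (T : tableau) (r c : nat) : nat := nth 0 (row T r) c.

Definition column (T : tableau) (c : nat) : seq nat :=
  [seq nth 0 s c | s <- T & c < size s].

Definition is_composition (alpha : seq nat) : Prop := 0 \notin alpha.

Definition partition_of (alpha : seq nat) : seq nat := sort geq alpha.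

Definition bijective_filling (alpha : seq nat) (T : tableau) : Prop :=
  shape T = alpha /\ perm_eq (flatten T) (iota 1 (sumn alpha)).

Definition rows_increase (T : tableau) : Prop := all (sorted ltn) T.

Definition SYT (lambda : seq nat) (T : tableau) : Prop :=
  [/\ bijective_filling lambda T,
      rows_increase T
    & forall r c, in_diagram T r.+1 c -> entry T r c < entry T r.+1 c].

(* In the last clause empty cells contain infinity: the premise forces (r', c)
   to be a cell, and the conclusion forces (r', c + 1) to be one. *)
Definition SYCT (alpha : seq nat) (T : tableau) : Prop :=
  [/\ bijective_filling alpha T,
      rows_increase T,
      sorted ltn (column T 0)
    & forall r r' c, r < r' -> in_diagram T r c.+1 ->
        in_diagram T r' c && (entry T r' c <= entry T r c.+1) ->
        in_diagram T r' c.+1 && (entry T r' c.+1 < entry T r c.+1)].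

Definition row_word (T : tableau) : seq nat := flatten (rev T).

Definition restrict (w : seq nat) (a b : nat) : seq nat :=
  [seq x <- w | a <= x <= b].

(* RSK row insertion: x replaces the leftmost entry greater than x, which is
   then inserted in the next row; x is appended if there is no such entry. *)
Fixpoint rsk_insert (P : tableau) (x : nat) : tableau :=
  if P is s :: P' then
    let j := find (ltn x) s in
    set_nth 0 s j x ::
      (if j < size s then rsk_insert P' (nth 0 s j) else P')
  else [:: [:: x]].

Definition rsk_tableau (w : seq nat) : tableau := foldl rsk_insert [::] w.

(* The parameters (i, m) stand for the interval [i, i + 2m]. *)
Definition dyck_pattern_interval (T : tableau) (i m : nat) : Prop :=
  [/\ 0 < i, 0 < m, i + m.*2 <= sumn (shape T),
      shape (rsk_tableau (restrict (row_word T) i (i + m.*2))) = [:: m.+1; m]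
    & shape (rsk_tableau (restrict (row_word T) i (i + m))) = [:: m.+1]].

(* The letters of w that are unpaired closed brackets, where letters > b are
   open and letters <= b are closed; d is the number of pending open brackets. *)
Fixpoint unpaired_closed (b d : nat) (w : seq nat) : seq nat :=
  if w is x :: w' then
    if b < x then unpaired_closed b d.+1 w'
    else if d is d'.+1 then unpaired_closed b d' w'
    else x :: unpaired_closed b 0 w'
  else [::].

(* For a Dyck pattern interval the list below has exactly one element. *)
Definition dyck_letter (T : tableau) (i m : nat) : nat :=
  head 0 (unpaired_closed (i + m) 0 (restrict (row_word T) i (i + m.*2))).

Definition map_entries (f : nat -> nat) (T : tableau) : tableau :=
  [seq [seq f x | x <- s] | s <- T].

Definition dyck_act (i m : nat) (T : tableau) : tableau :=
  let k := dyck_letter T i m in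
  map_entries (fun x => if x == k then k + m
                        else if k < x <= k + m then x.-1 else x) T.

Definition CS_edge (T T' : tableau) : Prop :=
  exists i m, dyck_pattern_interval T i m /\ T' = dyck_act i m T.

(* Places x in the highest unoccupied cell of column c > 0 whose left neighbour
   is smaller than x.  Rows stay left-justified, so the candidates are the rows
   of size c.  (There is always one when c is a column of a standard Young
   tableau; otherwise U is left unchanged.) *)
Definition place (c : nat) (U : tableau) (x : nat) : tableau :=
  let candidates := [seq r <- iota 0 (size U) |
                      (size (row U r) == c) && (entry U r c.-1 < x)] in
  if candidates is r0 :: rs then
    let r := last r0 rs in set_nth [::] U r (rcons (row U r) x)
  else U.

(* The inverse of the column-sorting bijection from standard Young composition
   tableaux to standard Young tableaux.  The columns of a standard Young tableau
   are already listed in increasing order by [column]. *)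
Definition phi_inv (T : tableau) : tableau :=
  foldl (fun U c => foldl (place c) U (column T c))
        [seq [:: x] | x <- column T 0]
        (iota 1 (size (row T 0)).-1).

Definition row_of (T : tableau) (x : nat) : nat := find (fun s => x \in s) T.

Definition col_of (T : tableau) (x : nat) : nat := index x (row T (row_of T x)).

Definition t_defined (i : nat) (T : tableau) : Prop :=
  [/\ SYCT (shape T) T, i \in flatten T, i.+1 \in flatten T,
      (col_of T i).+1 < col_of T i.+1 \/ (col_of T i.+1).+1 < col_of T i
    & row_of T i < row_of T i.+1].

Definition t_op (i : nat) (T : tableau) : tableau :=
  map_entries (fun x => if x == i then i.+1
                        else if x == i.+1 then i else x) T.

Definition QCS_vertex (alpha : seq nat) (T : tableau) : Prop :=
  SYT (partition_of alpha) T /\ shape (phi_inv T) = alpha.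

Definition QCS_edge (alpha : seq nat) (T T' : tableau) : Prop :=
  [/\ QCS_vertex alpha T, QCS_vertex alpha T' & CS_edge T T'].

Definition t_edge (alpha : seq nat) (T T' : tableau) : Prop :=
  [/\ QCS_vertex alpha T, QCS_vertex alpha T'
    & exists i, t_defined i (phi_inv T) /\ phi_inv T' = t_op i (phi_inv T)].

Definition QCS_plus_edge (alpha : seq nat) (T T' : tableau) : Prop :=
  QCS_edge alpha T T' \/ t_edge alpha T T'.

(* For a directed graph with vertex set V and edge relation E within V. *)
Definition connected_graph (X : Type) (V : X -> Prop) (E : X -> X -> Prop) :
  Prop :=
  (exists x, V x) /\
  forall x y, V x -> V y -> clos_refl_sym_trans X E x y.

(* Main.v *)
Require Import Defs.
From mathcomp Require Import all_boot zify.

(** A standard Young tableau is encoded by the word listing the column of each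
    of its entries 1, ..., n, and the standard Young composition tableau attached
    to it by [phi_inv] is built along this word: an entry of column c goes to the
    topmost row of length c.  On words, the [t_i] exchange consecutive letters
    that differ by more than 1, and the Dyck pattern intervals of length 3
    contain the local Knuth moves  a (a+1) a -> a a (a+1)  and
    a (a+1) (a+1) -> (a+1) a (a+1).  These edges already connect the graph.

    By induction on n, it suffices to join any composition tableau to one with n
    in the top row.  Suppose n closes a row of length c + 1 and let the top row
    have length b + 1; then c <> b + 1, as otherwise the top row would have been
    extended instead.  By induction the entries below n can be rearranged freely.
    If c and b differ by more than 1, put n - 1 at the end of the top row and
    exchange n - 1 and n.  If c = b or c = b - 1, put n - 2 and n - 1 at the end
    of the top row; a local Knuth move on n - 2, n - 1, n then brings n there. *)

Set Implicit Arguments.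
Unset Strict Implicit.
Unset Printing Implicit Defensive.

(** * Column words *)

Fixpoint grow (c : nat) (s : seq nat) : seq nat :=
  if s is b :: s' then if b == c then c.+1 :: s' else b :: grow c s' else [::].

Definition add_cell (c : nat) (s : seq nat) : seq nat :=
  if c is 0 then 1 :: s else grow c s.

(* The head of a word is the column of the largest entry; shapes list the top
   row first.  Hence [grow] extends the topmost row of size c, as the inverse of
   the column-sorting map does. *)
Fixpoint wshape (w : seq nat) : seq nat :=
  if w is c :: w' then add_cell c (wshape w') else [::].

Fixpoint valid (w : seq nat) : bool :=
  if w is c :: w' then ((c == 0) || (c \in wshape w')) && valid w' else true.

(** Since the head is the letter of the largest entry, the Knuth moves of the overview appear here
    read from right to left. [MoveFar] is symmetric in its two letters; the orientation required by
    the [t_i] is settled only when passing to tableaux. *)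
Inductive move : seq nat -> seq nat -> Prop :=
| MoveFar v u a b : (a.+1 < b) || (b.+1 < a) ->
    move (v ++ b :: a :: u) (v ++ a :: b :: u)
| MoveLeft v u a :
    move (v ++ a :: a.+1 :: a :: u) (v ++ a.+1 :: a :: a :: u)
| MoveRight v u a :
    move (v ++ a.+1 :: a.+1 :: a :: u) (v ++ a.+1 :: a :: a.+1 :: u).

(** Equality of shapes is a genuine condition: a Knuth move can change it, as [[:: 0; 1; 0]] and
    [[:: 1; 0; 0]] have shapes [[:: 1; 2]] and [[:: 2; 1]]. *)
Definition word_edge (w w' : seq nat) : Prop :=
  [/\ valid w, valid w', wshape w = wshape w' & move w w'].

Definition word_conn := clos_refl_sym_trans (seq nat) word_edge.

Lemma move_cons c w w' : move w w' -> move (c :: w) (c :: w').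
Proof.
by case=> [v u a b h|v u a|v u a]; rewrite -!cat_cons; constructor.
Qed.

Lemma word_conn_shape w w' : word_conn w w' -> wshape w = wshape w'.
Proof. by elim=> [? ? []|//|? ? _ ->|? ? ? _ -> _ ->]. Qed.

(** Whether the letter [c] may be added depends only on the shape, which is constant along a path.
    This makes the induction on the number of entries possible. *)
Lemma word_conn_cons c w w' :
  (c == 0) || (c \in wshape w) -> word_conn w w' -> word_conn (c :: w) (c :: w').
Proof.
move=> hc hw.
elim: {w w'} hw hc => [w w' [vw vw' eqs mv]|w|w w' hw IH|w1 w2 w3 h12 IH1 _ IH2] hc.
- apply: rst_step; split; rewrite /= ?vw ?vw' -?eqs ?hc //.
  exact: move_cons.
- exact: rst_refl.
- by apply/rst_sym/IH; rewrite (word_conn_shape hw).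
- by apply: rst_trans (IH1 hc) (IH2 _); rewrite -(word_conn_shape h12).
Qed.

Lemma zero_notin_grow c s : 0 \notin s -> 0 \notin grow c s.
Proof.
elim: s => //= b s IH; rewrite inE negb_or => /andP[hb hs].
by case: ifP => _; rewrite inE negb_or ?hs // hb IH.
Qed.

Lemma zero_notin_wshape w : 0 \notin wshape w.
Proof. by elim: w => // -[|c] w IH; rewrite ?inE //= zero_notin_grow. Qed.

Lemma sumn_grow c s : c \in s -> sumn (grow c s) = (sumn s).+1.
Proof.
elim: s => //= b s IH; rewrite inE eq_sym; case: eqVneq => [->|_] /=; first by [].
by move=> /IH ->; rewrite addnS.
Qed.

Lemma sumn_wshape w : valid w -> sumn (wshape w) = size w.
Proof.
elim: w => //= c w IH /andP[hc /IH {}IH].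
case: c hc => [|c] /= hc; first by rewrite IH.
by rewrite sumn_grow ?IH.
Qed.

(** The shape left when the last cell of a top row of length [b.+1] is removed; for [b = 0] the row
    itself disappears. *)
Definition top_row (b : nat) (s : seq nat) : seq nat :=
  if b is 0 then s else b :: s.

Lemma valid_grow_top b s w :
  valid w -> wshape w = top_row b s -> valid (b :: w) /\ wshape (b :: w) = b.+1 :: s.
Proof.
move=> vw hw; rewrite /= vw hw.
by case: b {hw} => [|b] /=; rewrite ?inE ?eqxx.
Qed.

Lemma valid_grow_below c b s w :
  0 < c -> c != b -> c \in s -> valid w -> wshape w = top_row b s ->
  valid (c :: w) /\ wshape (c :: w) = top_row b (grow c s).
Proof.
case: c => // c _ hb hc vw; rewrite /= vw => ->.
by case: b hb => [|b] hb /=; split; rewrite ?inE ?hc ?orbT // eq_sym (negPf hb).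
Qed.

(** The rows are filled one after the other from the bottom up, each from left to right; the row
    being filled is on top, so [grow] always selects it. *)
Lemma valid_word_exists s : 0 \notin s -> exists2 w, valid w & wshape w = s.
Proof.
elim: s => [|b s IH]; first by exists [::].
rewrite inE negb_or => /andP[hb /IH [w vw hw]].
case: b hb => // b _.
elim: b => [|b [w' vw' hw']]; first by exists (0 :: w); rewrite //= hw.
by have [] := @valid_grow_top b.+1 s w' vw' hw'; exists (b.+1 :: w').
Qed.

Lemma top_row_exists b s : 0 \notin s -> exists2 w, valid w & wshape w = top_row b s.
Proof. by move=> hs; apply: valid_word_exists; case: b => //= b; rewrite inE. Qed.

Lemma word_connected w w' :
  valid w -> valid w' -> wshape w = wshape w' -> word_conn w w'.
Proof.
have [n] := ubnP (size w); elim: n => // n IH in w w' *.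
(* It suffices to bring the largest entry into the top row. *)
have to_top b s v : size v <= n -> valid v -> wshape v = b.+1 :: s ->
    exists w0, [/\ valid w0, wshape w0 = top_row b s & word_conn v (b :: w0)].
  case: v => // c v hsz; rewrite [valid _]/= => /andP[hc vv] hs.
  (* The entries below the largest may be rearranged at will, by the induction hypothesis. *)
  have eqIH v' : valid v' -> wshape v = wshape v' -> word_conn (c :: v) (c :: v').
    by move=> vv' e; apply: word_conn_cons => //; apply: IH.
  have [c0|cn0] := eqVneq c 0.
    by subst c; case: hs => <- <-; exists v; split=> //; apply: rst_refl.
  have c_gt0 : 0 < c by lia.
  rewrite (negPf cn0) /= in hc.
  have bs : grow c (wshape v) = b.+1 :: s by move: hs c_gt0; rewrite /=; case: (c).
  case E: (wshape v) hc bs => [//|g t]; rewrite inE /= [c == g]eq_sym.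
  have z0 : 0 \notin t.
    by have := zero_notin_wshape v; rewrite E inE negb_or => /andP[].
  case: eqVneq => [gc _|gc /= ct] [].
    by move=> cb <-; subst; exists v; split=> //; [move: c_gt0 E; case: (b)|apply: rst_refl].
  move=> gb hst; subst g s.
  (* The top row has length [b.+1] and was not extended, so [gc] excludes [c = b.+1]. Hence [c] and
     [b] differ by more than 1 outside the first two cases. *)
  have [cb|cb] := eqVneq c b; last have [cb1|cb1] := eqVneq c.+1 b.
  - (* entries n-2, n-1, n in columns c-1, c, c, the first two in the top row *)
    subst c; case: b c_gt0 ct {hsz cn0 gc hs} E eqIH => // b _ ct E eqIH.
    have [w0 v0 s0] := top_row_exists b z0.
    have [v1 s1] := valid_grow_top v0 s0.
    have [v2 s2] := valid_grow_top (b := b.+1) v1 s1.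
    have [v1' s1'] := valid_grow_below (c := b.+1) (b := b) isT (ltac:(lia)) ct v0 s0.
    have [v2' s2'] := valid_grow_top v1' s1'.
    exists (b :: b.+1 :: w0); split=> //.
    apply: rst_trans (eqIH _ v2 _) _; first by rewrite s2.
    have [v3' s3'] := valid_grow_top (b := b.+1) v2' s2'.
    have [v3 s3] := valid_grow_below (c := b.+1) (b := b.+2) isT (ltac:(lia)) ct v2 s2.
    apply: rst_step; split=> //; first by rewrite s3 s3'.
    exact: (MoveRight [::]).
  - (* entries n-2, n-1, n in columns c, c+1, c, the first two in the top row *)
    subst b.
    have [w0 v0 s0] := top_row_exists c z0.
    have [v1 s1] := valid_grow_top v0 s0.
    have [v2 s2] := valid_grow_top (b := c.+1) v1 s1.
    have [v2' s2'] := valid_grow_below (c := c) (b := c.+1) c_gt0 (ltac:(lia)) ct v1 s1.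
    exists (c :: c :: w0); split=> //.
    apply: rst_trans (eqIH _ v2 _) _; first by rewrite s2.
    have [v3' s3'] := valid_grow_top (b := c.+1) v2' s2'.
    have [v3 s3] := valid_grow_below (c := c) (b := c.+2) c_gt0 (ltac:(lia)) ct v2 s2.
    apply: rst_step; split=> //; first by rewrite s3 s3'.
    exact: (MoveLeft [::]).
  - have [w0 v0 s0] := top_row_exists b z0.
    have [v1 s1] := valid_grow_top v0 s0.
    have [v1' s1'] := valid_grow_below c_gt0 cb ct v0 s0.
    exists (c :: w0); split=> //.
    apply: rst_trans (eqIH _ v1 _) _; first by rewrite s1.
    have [v2' s2'] := valid_grow_top v1' s1'.
    have [v2 s2] := valid_grow_below (c := c) (b := b.+1) c_gt0 (ltac:(lia)) ct v1 s1.
    apply: rst_step; split=> //; first by rewrite s2 s2'.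
    by apply: (MoveFar [::]); lia.
move=> hsz vw vw' eqs.
have eqsz : size w = size w' by rewrite -!sumn_wshape ?eqs.
case E: (wshape w) => [|[|b] s].
- have: size w = 0 by rewrite -sumn_wshape ?E.
  by case: w w' eqsz {hsz vw vw' eqs E} => // -[|//] _ _; apply: rst_refl.
- by have := zero_notin_wshape w; rewrite E.
have szn : size w <= n by [].
have [w1 [v1 s1 c1]] := to_top b s w szn vw E.
have [w2 [v2 s2 c2]] := to_top b s w' (ltac:(lia)) vw' (ltac:(by rewrite -eqs)).
have [v1' s1'] := valid_grow_top v1 s1.
have sz1 : size (b :: w1) = size w by rewrite -!sumn_wshape // s1' E.
(* Both words are now joined to words with head [b] whose tails have the same shape, and induction
   applies to the tails. *)
apply: rst_trans c1 _; apply: rst_trans (rst_sym _ _ _ _ c2).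
apply: word_conn_cons; first by rewrite s1; case: (b) => //= ?; rewrite inE eqxx.
by apply: IH; rewrite ?s1 ?s2 //; move: sz1 => /=; lia.
Qed.

(** * The standard Young tableau of a word *)

Lemma in_diagram_row_lt T r c : in_diagram T r c -> r < size T.
Proof.
by move=> h; rewrite ltnNge; apply/negP=> h'; move: h; rewrite /in_diagram /row nth_default.
Qed.

Lemma row_col_of_entry (T : tableau) r c :
  uniq (flatten T) -> in_diagram T r c ->
  row_of T (entry T r c) = r /\ col_of T (entry T r c) = c.
Proof.
move=> uT hrc.
have hrow : row_of T (entry T r c) = r.
  rewrite /row_of /entry /row; rewrite /in_diagram /row in hrc.
  elim: T r uT hrc => [|s T IH] [|r] //=; rewrite cat_uniq => /and3P[us dis uT].
    by move=> hc; rewrite mem_nth.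
  move=> hc; rewrite IH //; case: ifP => // xs.
  case/hasP: dis; exists (nth 0 (nth [::] T r) c) => //.
  apply/flattenP; exists (nth [::] T r); last exact: mem_nth.
  by apply: mem_nth; rewrite ltnNge; apply/negP=> h; rewrite nth_default in hc.
split=> //; rewrite /col_of hrow /entry index_uniq //.
rewrite /row; move: hrc uT; rewrite /in_diagram /row => {hrow} {c}_.
elim: T r => [|s T IH] [|r] //=; rewrite cat_uniq => /and3P[us _ uT] //.
exact: IH.
Qed.

Lemma entry_row_col_of (T : tableau) x :
  x \in flatten T ->
  in_diagram T (row_of T x) (col_of T x) /\ entry T (row_of T x) (col_of T x) = x.
Proof.
move=> /flattenP[s sT xs].
have hx : x \in row T (row_of T x).
  by apply: (nth_find [::] (a := fun s => x \in s)); apply/hasP; exists s.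
by rewrite /in_diagram /col_of index_mem hx /entry nth_index.
Qed.

Lemma entry_in_flatten (T : tableau) r c :
  in_diagram T r c -> entry T r c \in flatten T.
Proof.
move=> hc; apply/flattenP; exists (row T r); last exact: mem_nth.
exact: mem_nth (in_diagram_row_lt hc).
Qed.

Lemma tableau_ext (T T' : tableau) :
  shape T = shape T' ->
  (forall r c, in_diagram T r c -> entry T r c = entry T' r c) -> T = T'.
Proof.
move=> hs he.
have hsz : size T = size T' by rewrite -(size_map size T) -(size_map size T') -!/(shape _) hs.
apply: (eq_from_nth (x0 := [::])) => // r hr.
have hsr : size (nth [::] T r) = size (nth [::] T' r).
  have := congr1 (nth 0 ^~ r) hs.
  by rewrite /shape !(nth_map [::]) // -hsz.
by apply: (eq_from_nth (x0 := 0)) => // c; apply: he.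
Qed.

(** [column] skips short rows, so a position in it is a row index only if the rows reaching column
    [c] are the bottom ones, as in a partition shape. *)
Lemma column_mkseq (T : tableau) c k :
  (forall r, in_diagram T r c = (r < k)) ->
  column T c = mkseq (fun r => entry T r c) k.
Proof.
rewrite /column; elim: T k => [|s T IH] k hk.
  by case: k hk => // k /(_ 0).
have := hk 0; rewrite {1}/in_diagram /= => ->.
case: k hk => [|k] hk /=; first by apply: (IH 0) => r; exact: (hk r.+1).
rewrite (IH k) => [|r]; last exact: (hk r.+1).
by rewrite /mkseq /= -[in RHS](addn0 1) iotaDl -map_comp.
Qed.

Lemma mem_column (T : tableau) c x :
  reflect (exists2 r, in_diagram T r c & entry T r c = x) (x \in column T c).
Proof.
apply: (iffP mapP) => [[s]|[r hr <-]].
  rewrite mem_filter => /andP[hc sT] ->.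
  by exists (index s T); rewrite /in_diagram /entry /row nth_index.
exists (row T r) => //; rewrite mem_filter; apply/andP; split=> //.
exact: mem_nth (in_diagram_row_lt hr).
Qed.

(** The number of rows longer than [e] is the number of cells in column [e], and extending a row of
    length [c] adds a cell to column [c]. *)
Lemma count_grow c e (s : seq nat) : c \in s ->
  count (fun b => e < b) (grow c s) = count (fun b => e < b) s + (c == e).
Proof.
elim: s => //= b s IH; rewrite inE eq_sym; case: eqVneq => [->|_] /=; first lia.
by move=> /IH ->; lia.
Qed.

Lemma count_wshape w c :
  valid w -> count (fun b => c < b) (wshape w) = count_mem c w.
Proof.
elim: w => //= d w IH /andP[hd /IH {}IH].
case: d hd => [|d] /= hd; first by rewrite -IH; case: c {IH}.
by rewrite count_grow // IH addnC.
Qed.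

Lemma sorted_geq_nth s c r :
  sorted geq s -> (c < nth 0 s r) = (r < count (fun b => c < b) s).
Proof.
elim: s r => [|b s IH] r; first by rewrite nth_nil.
move=> hp; have hs := path_sorted hp.
have hall : all (geq b) s.
  by apply: (order_path_min (leT := geq)) hp => x y z /= h1 h2; apply: leq_trans h2 h1.
have h0 : ~~ (c < b) -> count (fun b => c < b) s = 0.
  move=> hcb; apply/eqP; rewrite -leqn0 leqNgt -has_count; apply/hasP=> -[x xs hx].
  by have := allP hall _ xs => /=; lia.
by case: r => [|r] /=; rewrite ?IH //; case: (ltnP c b) h0 => //= _ /(_ isT) ->.
Qed.

Lemma partition_sorted s : sorted geq (partition_of s).
Proof. by apply: sort_sorted => x y; apply: leq_total. Qed.

Lemma partition_perm s : perm_eq (partition_of s) s.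
Proof. by rewrite /partition_of perm_sort. Qed.

Lemma partition_rev s : partition_of (rev s) = partition_of s.
Proof.
have geq_tr : transitive geq by move=> x y z /= h1 h2; apply: leq_trans h2 h1.
have geq_as : antisymmetric geq by move=> x y /= /andP[]; lia.
have geq_to : total geq by move=> x y; apply: leq_total.
apply: (sorted_eq geq_tr geq_as); rewrite ?partition_sorted //.
by rewrite (permPl (partition_perm _)) perm_sym (permPl (partition_perm _)) perm_sym perm_rev.
Qed.

Lemma partition_wshape_nth w r c : valid w ->
  (c < nth 0 (partition_of (wshape w)) r) = (r < count_mem c w).
Proof.
move=> vw; rewrite (sorted_geq_nth _ _ (partition_sorted _)) -count_wshape //.
by have /permP -> := partition_perm (wshape w).
Qed.

(* The entries of column c, from smallest to largest. *)
Fixpoint pos (c : nat) (w : seq nat) : seq nat :=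
  if w is d :: w' then
    if d == c then rcons (pos c w') (size w) else pos c w'
  else [::].

Lemma size_pos c w : size (pos c w) = count_mem c w.
Proof.
by elim: w => //= d w IH; case: (d == c); rewrite ?size_rcons IH.
Qed.

Lemma pos_bound c w x : x \in pos c w -> 0 < x <= size w.
Proof.
elim: w => //= d w IH; case: eqP => _; rewrite ?mem_rcons ?inE.
  by case/orP=> [/eqP ->|/IH]; lia.
by move/IH; lia.
Qed.

Lemma pos_sorted c w : sorted ltn (pos c w).
Proof.
elim: w => //= d w IH; case: ifP => // _.
rewrite (sorted_pairwise ltn_trans) pairwise_rcons -(sorted_pairwise ltn_trans) IH andbT.
by apply/allP=> x /pos_bound /=; lia.
Qed.

(** The letter of entry [x] has index [size w - x], as the head belongs to the largest entry. *)
Lemma mem_pos c w x :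
  (x \in pos c w) = (0 < x <= size w) && (nth 0 w (size w - x) == c).
Proof.
elim: w => [|d w IH] /=; first by rewrite in_nil; case: x.
have [->|ne] := eqVneq x (size w).+1.
  rewrite subnn ltnSn /=; case: ifP => _; first by rewrite mem_rcons inE eqxx.
  by apply/negbTE/negP=> /pos_bound; lia.
have [hx|hx] := boolP (0 < x <= size w).
  rewrite (_ : (size w).+1 - x = (size w - x).+1) /=; last lia.
  rewrite (_ : 0 < x <= (size w).+1) /=; last lia.
  have {}IH : (x \in pos c w) = (nth 0 w (size w - x) == c) by rewrite IH hx.
  by case: (d == c); rewrite ?mem_rcons ?inE ?(negPf ne) IH.
rewrite (_ : (0 < x <= _) = false) /=; last by apply/negbTE; lia.
by case: (d == c); rewrite ?mem_rcons ?inE ?(negPf ne) IH (negPf hx).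
Qed.

Lemma nth_pos v u c :
  nth 0 (pos c (v ++ c :: u)) (count_mem c u) = (size u).+1.
Proof.
elim: v => [|d v IH] /=.
  by rewrite eqxx nth_rcons size_pos ltnn eqxx.
case: ifP => _ //; rewrite nth_rcons size_pos ifT //.
by rewrite count_cat /= eqxx; lia.
Qed.

Lemma valid_catr v u : valid (v ++ u) -> valid u.
Proof. by elim: v => //= c v IH /andP[_]. Qed.

Lemma count_next w c : valid w -> count_mem c.+1 w <= count_mem c w.
Proof. by move=> vw; rewrite -!count_wshape //; apply: sub_count => b; lia. Qed.

(** A row of length exactly [c.+1] is one that reaches column [c] but not column [c.+1]. Validity is
    therefore the lattice word condition, which depends on letter counts only. *)
Lemma mem_wshape c w : valid w ->
  (c.+1 \in wshape w) = (count_mem c.+1 w < count_mem c w).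
Proof.
move=> vw; rewrite -!count_wshape //.
elim: (wshape w) => //= b s IHs; rewrite inE.
have hle : count (fun b => c.+1 < b) s <= count (fun b => c < b) s.
  by apply: sub_count => z; lia.
by have [e|ne] := eqVneq c.+1 b; rewrite /= ?IHs; lia.
Qed.

Lemma pos_next w c r : valid w -> r < count_mem c.+1 w ->
  nth 0 (pos c w) r < nth 0 (pos c.+1 w) r.
Proof.
elim: w => //= d w IH /andP[hd vw]; have := count_next c vw.
have [e|ne] := eqVneq d c.+1 => /= le.
  subst d.
  rewrite ifF; last by apply/eqP; lia.
  rewrite add1n nth_rcons size_pos => hr; case: (ltnP r) => hr'; first exact: IH.
  (* The new entry is the one in question. By validity column [c] already has a cell in row [r], and
     its entry is older, hence at most [size w]. *)
  have er : r = count_mem c.+1 w by apply/anti_leq; rewrite hr' andbT -ltnS.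
  rewrite {2}er eqxx.
  have hin: r < count_mem c w.
    by rewrite er -mem_wshape.
  have := @pos_bound c w (nth 0 (pos c w) r) (mem_nth _ _).
  by rewrite size_pos => /(_ hin); lia.
rewrite add0n => hr.
case: eqP => [e|_]; last exact: IH.
by rewrite nth_rcons size_pos (leq_trans hr le) IH.
Qed.

(** The usual passage from lattice words to standard Young tableaux, with letters recording columns
    instead of rows. *)
Definition Tab (w : seq nat) : tableau :=
  let la := partition_of (wshape w) in
  mkseq (fun r => mkseq (fun c => nth 0 (pos c w) r) (nth 0 la r)) (size la).

Lemma shape_Tab w : shape (Tab w) = partition_of (wshape w).
Proof.
rewrite /shape /Tab /mkseq -map_comp; set la := partition_of _.
rewrite -[RHS](mkseq_nth 0); apply: eq_map => r /=.
by rewrite size_map size_iota.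
Qed.

Lemma size_row_Tab w r : size (row (Tab w) r) = nth 0 (partition_of (wshape w)) r.
Proof.
rewrite /row -shape_Tab; have [h|h] := ltnP r (size (Tab w)).
  by rewrite /shape (nth_map [::]).
by rewrite (nth_default [::] h) nth_default // size_map.
Qed.

Lemma in_diagram_Tab w r c : valid w -> in_diagram (Tab w) r c = (r < count_mem c w).
Proof. by move=> vw; rewrite /in_diagram size_row_Tab partition_wshape_nth. Qed.

Lemma entry_Tab w r c : in_diagram (Tab w) r c -> entry (Tab w) r c = nth 0 (pos c w) r.
Proof.
rewrite /in_diagram size_row_Tab /entry => hc.
have hr : r < size (partition_of (wshape w)).
  by rewrite ltnNge; apply/negP=> h; rewrite nth_default in hc.
by rewrite /row /Tab nth_mkseq // nth_mkseq.
Qed.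

Lemma column_Tab w c : valid w -> column (Tab w) c = pos c w.
Proof.
move=> vw; rewrite (@column_mkseq _ _ (count_mem c w)); last by move=> r; rewrite in_diagram_Tab.
rewrite -[RHS](mkseq_nth 0) size_pos; apply/eq_in_map => r; rewrite mem_iota => hr.
by rewrite entry_Tab // in_diagram_Tab.
Qed.

Lemma sumn_partition s : sumn (partition_of s) = sumn s.
Proof. exact: perm_sumn (partition_perm s). Qed.

Lemma Tab_SYT w : valid w -> SYT (partition_of (wshape w)) (Tab w).
Proof.
move=> vw; split.
- split; first exact: shape_Tab.
  rewrite perm_sym sumn_partition sumn_wshape //.
  (* Every number from 1 to [size w] occurs in the column named by its letter, and there are only
     [size w] cells, so each occurs once. *)
  have sub : {subset iota 1 (size w) <= flatten (Tab w)}.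
    move=> x; rewrite mem_iota => hx.
    have : x \in pos (nth 0 w (size w - x)) w by rewrite mem_pos eqxx; lia.
    rewrite -(column_Tab _ vw) => /mem_column[r hr <-].
    exact: entry_in_flatten.
  have sz : size (flatten (Tab w)) <= size (iota 1 (size w)).
    by rewrite size_flatten shape_Tab sumn_partition sumn_wshape // size_iota.
  have [_ e] := uniq_min_size (iota_uniq _ _) sub sz.
  by apply: uniq_perm => //; [apply: iota_uniq|apply: leq_size_uniq sub sz; apply: iota_uniq].
- apply/(all_nthP [::]) => r hr.
  apply/(sortedP 0) => c hc.
  have hd : in_diagram (Tab w) r c.+1 by [].
  have hd' : in_diagram (Tab w) r c by apply: ltnW.
  have := entry_Tab hd; have := entry_Tab hd'.
  rewrite /entry /row => -> ->.
  by apply: pos_next => //; rewrite -in_diagram_Tab.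
- move=> r c hd; have hd' : in_diagram (Tab w) r c.
    by move: hd; rewrite !in_diagram_Tab //; lia.
  rewrite !entry_Tab //; rewrite in_diagram_Tab // -size_pos in hd.
  by have /(sortedP 0) := pos_sorted c w; apply.
Qed.

Lemma sorted_ltn_count s r x : sorted ltn s -> r < size s ->
  (nth 0 s r < x) = (r < count (fun y => y < x) s).
Proof.
elim: s r => //= b s IH r hp; have hs := path_sorted hp.
have hall : all (ltn b) s := order_path_min ltn_trans hp.
have h0 : ~~ (b < x) -> count (fun y => y < x) s = 0.
  move=> hcb; apply/eqP; rewrite -leqn0 leqNgt -has_count; apply/hasP=> -[y ys hy].
  by have := allP hall _ ys => /=; lia.
by case: r => [|r] /= hr; rewrite ?IH //; case: (ltnP b x) h0 => //= _ /(_ isT) ->.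
Qed.

Lemma count_eq_size_nonzero (s : seq nat) : 0 \notin s -> count (fun b => 0 < b) s = size s.
Proof.
move=> h; apply/eqP; rewrite -all_count; apply/allP=> x xs.
by rewrite lt0n; apply: contraNneq h => <-.
Qed.

(** A partition is determined by its column lengths. Since zero parts are excluded, the case [c = 0]
    compares the numbers of parts. *)
Lemma partition_ext (s t : seq nat) : 0 \notin s -> 0 \notin t ->
  (forall c, count (fun b => c < b) s = count (fun b => c < b) t) ->
  partition_of s = partition_of t.
Proof.
move=> s0 t0 h.
have cP u c : count (fun b => c < b) (partition_of u) = count (fun b => c < b) u.
  by have /permP -> := partition_perm u.
apply: (eq_from_nth (x0 := 0)) => [|r _].
  by rewrite !(perm_size (partition_perm _)) -!count_eq_size_nonzero.
have E c : (c < nth 0 (partition_of s) r) = (c < nth 0 (partition_of t) r).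
  by rewrite !sorted_geq_nth ?partition_sorted // !cP h.
have := E (nth 0 (partition_of s) r); have := E (nth 0 (partition_of t) r); lia.
Qed.

Lemma SYT_is_Tab (alpha : seq nat) (T : tableau) :
  0 \notin alpha -> SYT (partition_of alpha) T ->
  exists w, [/\ valid w, partition_of (wshape w) = partition_of alpha & T = Tab w].
Proof.
move=> al0 [[hsh hpm] hrow hcol].
set n := sumn _ in hpm.
have uT : uniq (flatten T) by rewrite (perm_uniq hpm) iota_uniq.
have diag r c : in_diagram T r c = (r < count (fun b => c < b) alpha).
  rewrite /in_diagram; have /permP <- := partition_perm alpha.
  rewrite -sorted_geq_nth ?partition_sorted // -hsh /row /shape.
  have [h|h] := ltnP r (size T); first by rewrite (nth_map [::]).
  by rewrite (nth_default [::] h) nth_default // size_map.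
have colE c : column T c = mkseq (fun r => entry T r c) (count (fun b => c < b) alpha).
  by apply: column_mkseq.
have nth_col r c : in_diagram T r c -> nth 0 (column T c) r = entry T r c.
  by rewrite diag => h; rewrite colE nth_mkseq.
have size_col c : size (column T c) = count (fun b => c < b) alpha.
  by rewrite colE size_mkseq.
have colS c : sorted ltn (column T c).
  apply/(sortedP 0) => r; rewrite size_col -diag => h.
  by rewrite !nth_col //; [apply: hcol|move: h; rewrite !diag; apply: ltnW].
(* [wk k] is the column word of the entries up to [k]; [wk n] is the required word, and its prefixes
   serve to prove validity by induction. *)
pose wk k := rev [seq col_of T x | x <- iota 1 k].
have wkS k : wk k.+1 = col_of T k.+1 :: wk k.
  by rewrite /wk -(addn1 k) iotaD map_cat rev_cat /= add1n addn1.
have size_wk k : size (wk k) = k by rewrite size_rev size_map size_iota.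
have posE k c : k <= n -> pos c (wk k) = [seq x <- column T c | x < k.+1].
  move=> hk; apply: (irr_sorted_eq ltn_trans ltnn); rewrite ?pos_sorted //.
    exact: sorted_filter ltn_trans _ _ (colS c).
  move=> x; rewrite mem_pos mem_filter size_wk.
  have mem_xT : (x \in flatten T) = (0 < x <= n).
    by rewrite (perm_mem hpm) mem_iota; lia.
  apply/idP/idP=> [/andP[hx]|/andP[hx /mem_column[r hr e]]].
    rewrite /wk nth_rev ?size_map ?size_iota; last lia.
    rewrite (_ : k - (k - x).+1 = x.-1); last lia.
    rewrite (nth_map 0) ?size_iota ?nth_iota; try lia.
    rewrite (_ : 1 + x.-1 = x); last lia.
    move=> /eqP <-; apply/andP; split; first lia.
    have [h1 h2] := @entry_row_col_of T x (ltac:(rewrite mem_xT; lia)).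
    by apply/mem_column; exists (row_of T x).
  have [_ ce] := row_col_of_entry uT hr; rewrite e in ce.
  have hx' : 0 < x <= n by rewrite -mem_xT -e entry_in_flatten.
  rewrite /wk nth_rev ?size_map ?size_iota; last lia.
  rewrite (_ : k - (k - x).+1 = x.-1); last lia.
  rewrite (nth_map 0) ?size_iota ?nth_iota; try lia.
  rewrite (_ : 1 + x.-1 = x); last lia.
  by rewrite ce eqxx andbT; lia.
have countE k c : k <= n -> count_mem c (wk k) = count (fun x => x < k.+1) (column T c).
  by move=> hk; rewrite -size_pos posE // size_filter.
(* Let [k.+1] lie in row [r] and column [c.+1]. Its left neighbour is smaller, so column [c] has
   more than [r] entries up to [k], while column [c.+1] has at most [r]: the lattice condition
   holds. *)
have vk k : k <= n -> valid (wk k).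
  elim: k => // k IH hk; rewrite wkS /= IH ?andbT; last lia.
  have [h1 h2] := @entry_row_col_of T k.+1 (ltac:(rewrite (perm_mem hpm) mem_iota; lia)).
  move: (row_of T k.+1) (col_of T k.+1) h1 h2 => r [|c] // h1 h2.
  rewrite /= mem_wshape ?countE; try (by apply: IH; lia); try lia.
  have h1' : in_diagram T r c by move: h1; rewrite /in_diagram; lia.
  have lt : entry T r c < k.+1.
    rewrite -h2 /entry.
    have hs : sorted ltn (row T r).
      by apply: (allP hrow); apply: mem_nth; apply: in_diagram_row_lt h1.
    by have /(sortedP 0) := hs; apply.
  have e1 : r < count (fun x => x < k.+1) (column T c).
    by rewrite -sorted_ltn_count ?size_col -?diag // nth_col.
  have e2 : (r < count (fun x => x < k.+1) (column T c.+1)) = false.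
    by rewrite -sorted_ltn_count ?size_col -?diag // nth_col // h2 ltnn.
  by apply: leq_trans e1; rewrite ltnS leqNgt e2.
have pos_n c : pos c (wk n) = column T c.
  rewrite posE //; apply/all_filterP/allP=> x /mem_column[r hr <-].
  by have := entry_in_flatten hr; rewrite (perm_mem hpm) mem_iota; lia.
have vn := vk n (leqnn n).
have shn : partition_of (wshape (wk n)) = partition_of alpha.
  apply: partition_ext => // [|c]; first exact: zero_notin_wshape.
  by rewrite count_wshape // -size_pos pos_n size_col.
exists (wk n); split=> //.
apply: tableau_ext => [|r c hd]; first by rewrite shape_Tab shn.
rewrite entry_Tab ?pos_n ?nth_col // in_diagram_Tab //.
by rewrite -size_pos pos_n size_col -diag.
Qed.

(** * The composition tableau of a word *)

(** Tableau versions of [grow], [add_cell] and [wshape] follow. Rows are listed from top to bottom,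
    so that the first match is the topmost row of the given length; [Utab] restores the order from
    bottom to top. *)
Fixpoint append_to (c x : nat) (V : tableau) : tableau :=
  if V is s :: V' then
    if size s == c then rcons s x :: V' else s :: append_to c x V'
  else [::].

Definition add_entry (c x : nat) (V : tableau) : tableau :=
  if c is 0 then [:: x] :: V else append_to c x V.

Fixpoint Utop (w : seq nat) : tableau :=
  if w is c :: w' then add_entry c (size w) (Utop w') else [::].

Lemma shape_add_entry c x V : shape (add_entry c x V) = add_cell c (shape V).
Proof.
case: c => // c; rewrite /=; elim: V => //= s V IH.
by case: eqP => /= [<-|_]; rewrite ?size_rcons // -IH.
Qed.

Lemma shape_Utop w : shape (Utop w) = wshape w.
Proof. by elim: w => //= c w IH; rewrite shape_add_entry IH. Qed.

Lemma flatten_add_entry c x V : (c == 0) || (c \in shape V) ->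
  perm_eq (flatten (add_entry c x V)) (x :: flatten V).
Proof.
case: c => // c; rewrite [_ || _]/= [add_entry _ _ _]/=.
elim: V => //= s V IH; rewrite inE eq_sym; case: eqP => /= [_ _|_ /IH {}IH].
  by rewrite -cats1 -catA perm_catCA.
by rewrite (permPl (perm_cat (perm_refl s) IH)) -cat1s perm_catCA.
Qed.

Lemma column_add_entry c x V e : (c == 0) || (c \in shape V) ->
  perm_eq (column (add_entry c x V) e) ((if c == e then [:: x] else [::]) ++ column V e).
Proof.
case: c => [|c]; rewrite [_ || _]/= [add_entry _ _ _]/=.
  by move=> _; rewrite /column /=; case: e.
rewrite /column; elim: V => //= s V IH; rewrite inE eq_sym; case: eqP => /= [hs _|_ /IH {}IH].
  rewrite size_rcons hs ltnS leq_eqVlt eq_sym; case: eqVneq => [e1|ne] /=.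
    by subst e; rewrite ltnn /= nth_rcons hs ltnn eqxx.
  case: ifP => // h; rewrite /= nth_rcons hs h //.
case: ifP => //= h.
rewrite -(perm_cons (nth 0 s e)) in IH; rewrite (permPl IH).
exact: permEl (perm_catCA [:: nth 0 s e] _ _).
Qed.

(** The composition tableau and [Tab w] have the same column contents, so sorting columns sends the
    former to the latter. *)
Lemma column_Utop w c : valid w -> perm_eq (column (Utop w) c) (pos c w).
Proof.
elim: w => //= d w IH /andP[hd vw].
have hd' : (d == 0) || (d \in shape (Utop w)) by rewrite shape_Utop.
rewrite (permPl (column_add_entry _ _ hd')); case: ifP => _ /=; last exact: IH.
by rewrite perm_sym perm_rcons perm_cons perm_sym IH.
Qed.

Lemma column_rev (V : tableau) c : column (rev V) c = rev (column V c).
Proof. by rewrite /column filter_rev map_rev. Qed.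

Lemma flatten_Utop w : valid w -> perm_eq (flatten (Utop w)) (iota 1 (size w)).
Proof.
elim: w => //= d w IH /andP[hd vw].
have hd' : (d == 0) || (d \in shape (Utop w)) by rewrite shape_Utop.
rewrite (permPl (flatten_add_entry _ hd')) -/(iota 1 (size w).+1).
have -> : iota 1 (size w).+1 = rcons (iota 1 (size w)) (size w).+1.
  by rewrite -{1}(addn1 (size w)) iotaD cats1 add1n.
rewrite perm_sym perm_rcons perm_cons perm_sym.
exact: IH.
Qed.

(* Clause (3) of the definition of [SYCT], for a row s lying below a row t. *)
Definition row_compat (t s : seq nat) : Prop :=
  forall c, c.+1 < size s -> c < size t -> nth 0 t c <= nth 0 s c.+1 ->
  c.+1 < size t /\ nth 0 t c.+1 < nth 0 s c.+1.

Fixpoint rows_compat (V : tableau) : Prop :=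
  if V is t :: V' then (forall s, s \in V' -> row_compat t s) /\ rows_compat V'
  else True.

Lemma mem_append_to c x V s : s \in append_to c x V ->
  s \in V \/ exists s', [/\ s = rcons s' x, s' \in V & size s' = c].
Proof.
elim: V => //= t V IH; case: eqP => [<-|_]; rewrite !inE => /orP[/eqP ->|h].
- by right; exists t; rewrite inE eqxx.
- by left; rewrite h orbT.
- by left; rewrite eqxx.
- case: (IH h) => [h'|[s' [-> h1 h2]]]; [left|right]; rewrite ?h' ?orbT //.
  by exists s'; rewrite inE h1 orbT.
Qed.

(** The new entry exceeds all others, so as the left entry of an upper row it never meets the
    premise of clause (3). If it ends a lower row, the topmost choice ensures that the rows above it
    have a different length, which gives the conclusion. *)
Lemma rows_compat_add_entry c x V :
  (forall y, y \in flatten V -> y < x) -> rows_compat V -> rows_compat (add_entry c x V).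
Proof.
have nth_lt s V' e : (forall y, y \in flatten V' -> y < x) -> s \in V' ->
    e < size s -> nth 0 s e < x.
  by move=> ltx sV he; apply: ltx; apply/flattenP; exists s => //; apply: mem_nth.
case: c => [|c] ltx hV.
  split=> // s sV e h1; rewrite /= ltnS leqn0 => /eqP e0; subst e => /=.
  by have := nth_lt s V 1 ltx sV h1; lia.
rewrite [add_entry _ _ _]/=; elim: V ltx hV => //= t V IH ltx [htV hV].
have ltx' : forall y, y \in flatten V -> y < x.
  by move=> y hy; apply: ltx; rewrite mem_cat hy orbT.
have ltt e : e < size t -> nth 0 t e < x.
  by move=> he; apply: ltx; rewrite mem_cat mem_nth.
case: eqP => [szt|szt] /=; split=> //; last exact: IH.
  move=> s sV e h1; rewrite size_rcons ltnS leq_eqVlt !nth_rcons => /orP[/eqP h2|h2].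
    rewrite h2 ltnn eqxx => h3.
    by have := nth_lt s V e.+1 ltx' sV h1; rewrite h2; lia.
  rewrite h2 => h3; have [h4 h5] := htV s sV e h1 h2 h3.
  by rewrite h4; split=> //; lia.
(* Here [t] was passed over, so its length differs from that of [s']; the premise gives
   [size s' <= size t], hence a strict inequality. *)
move=> s /mem_append_to[/htV //|[s' [-> s'V szs]]] e.
rewrite size_rcons ltnS leq_eqVlt nth_rcons => /orP[/eqP h1|h1] h2.
  rewrite h1 ltnn eqxx => _; have h3 : size s' < size t by lia.
  by split=> //; apply: ltt.
by rewrite h1; apply: htV.
Qed.

Lemma rows_compatP V i j : rows_compat V -> i < j < size V ->
  row_compat (nth [::] V i) (nth [::] V j).
Proof.
elim: V i j => [|t V IH] [|i] [|j] //=; try by move=> _; rewrite andbF.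
  by move=> [h _] hj; apply: h; apply: mem_nth.
by move=> [_ h] hij; apply: IH.
Qed.

Lemma rows_increase_add_entry c x V :
  (forall y, y \in flatten V -> y < x) -> all (sorted ltn) V ->
  all (sorted ltn) (add_entry c x V).
Proof.
case: c => [//|c] ltx; rewrite [add_entry _ _ _]/=.
elim: V ltx => //= t V IH ltx /andP[ht hV].
case: eqP => _ /=; rewrite ?ht ?hV ?andbT /=; last first.
  by apply: IH => // y hy; apply: ltx; rewrite mem_cat hy orbT.
rewrite (sorted_pairwise ltn_trans) pairwise_rcons -(sorted_pairwise ltn_trans) ht andbT.
by apply/allP=> y hy /=; apply: ltx; rewrite mem_cat hy.
Qed.

Lemma rows_compat_Utop w : valid w -> rows_compat (Utop w) /\ all (sorted ltn) (Utop w).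
Proof.
elim: w => //= c w IH /andP[_ vw]; have [h1 h2] := IH vw.
have lt y : y \in flatten (Utop w) -> y < (size w).+1.
  by rewrite (perm_mem (flatten_Utop vw)) mem_iota; lia.
by split; [apply: rows_compat_add_entry|apply: rows_increase_add_entry].
Qed.

Lemma column0_append_to c x V : 0 \notin shape V -> 0 < c ->
  column (append_to c x V) 0 = column V 0.
Proof.
move=> h c0; rewrite /column; elim: V h => //= s V IH; rewrite inE negb_or => /andP[hs hV].
case: eqP => [e|_] /=; last by case: ifP => _ /=; rewrite IH.
by rewrite size_rcons e c0 /= nth_rcons e c0.
Qed.

(** Each entry of column 0 opens a new row on top, which makes the leftmost column monotone. *)
Lemma column0_Utop w : valid w -> column (Utop w) 0 = rev (pos 0 w).
Proof.
elim: w => //= -[|c] w IH /= vw; first by rewrite rev_rcons -IH.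
have /andP[_ {}vw] := vw.
by rewrite column0_append_to ?IH // shape_Utop zero_notin_wshape.
Qed.

Definition Utab (w : seq nat) : tableau := rev (Utop w).

Lemma shape_Utab w : shape (Utab w) = rev (wshape w).
Proof. by rewrite /Utab /shape map_rev -/(shape _) shape_Utop. Qed.

Lemma flatten_Utab w : valid w -> perm_eq (flatten (Utab w)) (iota 1 (size w)).
Proof.
by move=> vw; rewrite -(permPr (flatten_Utop vw)) perm_flatten // perm_rev.
Qed.

Lemma column_Utab w c : valid w -> perm_eq (column (Utab w) c) (pos c w).
Proof. by move=> vw; rewrite column_rev perm_rev column_Utop. Qed.

Lemma Utab_SYCT w : valid w -> SYCT (rev (wshape w)) (Utab w).
Proof.
move=> vw; have [hc hr] := rows_compat_Utop vw; split.
- split; first exact: shape_Utab.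
  by rewrite sumn_rev sumn_wshape // flatten_Utab.
- by rewrite /rows_increase all_rev.
- by rewrite column_rev column0_Utop // revK pos_sorted.
- move=> r r' c hlt h1 /andP[h2 h3].
  have s1 := in_diagram_row_lt h1; have s2 := in_diagram_row_lt h2.
  rewrite size_rev in s1 s2.
  move: h1 h2 h3; rewrite /in_diagram /entry /row /Utab !nth_rev // => h1 h2 h3.
  apply/andP; apply: rows_compatP h1 h2 h3 => //; lia.
Qed.

(** * Recovering a composition tableau from its sorted columns *)

Lemma filter_iota_last (P : pred nat) n r :
  r < n -> P r -> (forall r', r < r' -> r' < n -> ~~ P r') ->
  [seq i <- iota 0 n | P i] = rcons [seq i <- iota 0 r | P i] r.
Proof.
move=> rn Pr hP; have -> : n = r + (1 + (n - r.+1)) by lia.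
rewrite iotaD filter_cat /= Pr add0n -cats1; congr (_ ++ _ :: _).
apply/eqP; rewrite -size_eq0 size_filter -leqn0 leqNgt -has_count.
by apply/hasP=> -[i]; rewrite mem_iota => hi; apply/negP/hP; lia.
Qed.

Lemma place_at c (U : tableau) x r :
  let P r := (size (row U r) == c) && (entry U r c.-1 < x) in
  r < size U -> P r -> (forall r', r < r' -> r' < size U -> ~~ P r') ->
  place c U x = set_nth [::] U r (rcons (row U r) x).
Proof.
move=> P h1 h2 h3; rewrite /place (filter_iota_last h1 h2 h3).
by case: [seq i <- iota 0 r | P i] => [|r0 rs] //=; rewrite last_rcons.
Qed.

(* The cells of U in the columns before c, and those of column c with entry in D. *)
Definition trunc (c : nat) (D : seq nat) (U : tableau) : tableau :=
  [seq take (c + (nth 0 s c \in D)) s | s <- U].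

Lemma row_trunc c D U r :
  row (trunc c D U) r = take (c + (entry U r c \in D)) (row U r).
Proof.
rewrite /row /trunc /entry; have [h|h] := ltnP r (size U); first by rewrite (nth_map [::]).
by rewrite !(nth_default [::]) ?size_map.
Qed.

Lemma SYCT_row_lt alpha U r c : SYCT alpha U ->
  in_diagram U r c.+1 -> entry U r c < entry U r c.+1.
Proof.
move=> [_ hr _ _] hd.
have /(sortedP 0) : sorted ltn (row U r) by apply: (allP hr); apply: mem_nth; apply: in_diagram_row_lt hd.
exact.
Qed.

(** When the entries smaller than [x] in column [c.+1] are in place, [x] goes to the row it occupies
    in [U]: clause (3) rules out every higher candidate. *)
Lemma place_trunc alpha U c D x xs :
  SYCT alpha U -> sorted ltn (D ++ x :: xs) -> column U c.+1 =i D ++ x :: xs ->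
  place c.+1 (trunc c.+1 D U) x = trunc c.+1 (rcons D x) U.
Proof.
move=> hU; have [[_ hpm] _ _ h3] := hU; move=> sL eL.
have uU : uniq (flatten U) by rewrite (perm_uniq hpm) iota_uniq.
move: sL; rewrite (sorted_pairwise ltn_trans) pairwise_cat /= => /and4P[hD _ hx _].
have ltD y : y \in D -> y < x.
  by move=> yD; have /allrelP := hD; apply => //; rewrite inE eqxx.
have xD : x \notin D by apply/negP=> /ltD; rewrite ltnn.
have inD y : y \in D ++ x :: xs -> y < x -> y \in D.
  rewrite mem_cat inE => /or3P[//|/eqP ->|hy]; first by rewrite ltnn.
  by have := allP hx _ hy => /=; lia.
have /mem_column[r hr er] : x \in column U c.+1 by rewrite eL mem_cat inE eqxx orbT.
have rU := in_diagram_row_lt hr.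
rewrite (@place_at _ _ _ r); first last.
(* In a higher row whose entry in column [c] is below [x], clause (3) puts an entry below [x] in
   column [c.+1]. It belongs to [D], so the cell is already occupied. *)
- move=> r' lt _; apply/negP=> /andP[/eqP]; rewrite /entry row_trunc => hsz.
  rewrite nth_take; last by rewrite /=; lia.
  move=> hlt.
  have hd' : in_diagram U r' c.
    rewrite /in_diagram ltnNge; apply/negP=> h.
    by move: hsz; rewrite take_oversize; lia.
  have /andP[h1 h2] : in_diagram U r' c.+1 && (entry U r' c.+1 < entry U r c.+1).
    by apply: h3 => //; rewrite hd' er ltnW.
  rewrite er in h2.
  have e1 : entry U r' c.+1 \in D.
    by apply: inD => //; rewrite -eL; apply/mem_column; exists r'.
  rewrite /in_diagram in h1; move: hsz; rewrite e1 size_take.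
  by case: ltnP; lia.
- rewrite /entry row_trunc er (negPf xD) addn0 size_take (hr : c.+1 < size _) eqxx /=.
  rewrite nth_take // -er; exact: SYCT_row_lt hU hr.
- by rewrite size_map.
apply: (eq_from_nth (x0 := [::])) => [|i hi].
  by rewrite size_set_nth !size_map; lia.
rewrite nth_set_nth /= -/(row (trunc _ _ _) _) -/(row _ i) !row_trunc.
case: eqP => [->|/eqP ne].
  rewrite er (negPf xD) mem_rcons inE eqxx addn0 addn1.
  by rewrite (take_nth 0 (hr : c.+1 < size _)) -er.
rewrite mem_rcons inE.
(* For a row without a cell in column [c.+1], [entry] returns the default 0; this is harmless, as
   [take] then keeps the whole row. *)
have [h|h] := leqP (size (row U i)) c.+1.
  by rewrite !take_oversize //; lia.
suff /negPf -> : entry U i c.+1 != x by [].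
apply: contra ne => /eqP e; apply/eqP.
have [<- _] := row_col_of_entry uU (h : in_diagram U i c.+1).
by have [<- _] := row_col_of_entry uU hr; rewrite e er.
Qed.

Lemma foldl_place_trunc alpha U c D xs :
  SYCT alpha U -> sorted ltn (D ++ xs) -> column U c.+1 =i D ++ xs ->
  foldl (place c.+1) (trunc c.+1 D U) xs = trunc c.+1 (D ++ xs) U.
Proof.
move=> hU; elim: xs D => [|x xs IH] D; first by rewrite cats0.
by move=> sL eL /=; rewrite (place_trunc hU sL eL) IH cat_rcons.
Qed.

Lemma foldl_place_column alpha U c L :
  SYCT alpha U -> sorted ltn L -> perm_eq (column U c.+1) L ->
  foldl (place c.+1) (map (take c.+1) U) L = map (take c.+2) U.
Proof.
move=> hU sL pL.
have -> : map (take c.+1) U = trunc c.+1 [::] U by apply: eq_map => s; rewrite addn0.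
rewrite (foldl_place_trunc hU) //; last exact: perm_mem.
apply/eq_in_map => s sU; have [h|h] := leqP (size s) c.+1.
  by rewrite !take_oversize //; [apply: leqW|apply: leq_trans h (leq_addr _ _)].
rewrite -(perm_mem pL) (_ : nth 0 s c.+1 \in _) ?addn1 //.
by apply/mapP; exists s => //; rewrite mem_filter h.
Qed.

Lemma phi_inv_of_SYCT alpha U T :
  SYCT alpha U -> 0 \notin alpha ->
  (forall c, sorted ltn (column T c)) ->
  (forall c, perm_eq (column U c) (column T c)) ->
  (forall c, size (row T 0) <= c -> column T c = [::]) ->
  phi_inv T = U.
Proof.
move=> hU al0 sT pT hT; have [[hsh _] _ hc0 _] := hU.
have col0 : column T 0 = column U 0.
  by apply: (irr_sorted_eq ltn_trans ltnn) => // x; rewrite (perm_mem (pT 0)).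
rewrite /phi_inv col0.
have -> : [seq [:: x] | x <- column U 0] = map (take 1) U.
  have : all (fun s => 0 < size s) U.
    apply/allP=> s sU; rewrite lt0n; apply: contraNneq al0 => <-.
    by rewrite -hsh; apply: map_f.
  rewrite /column; elim: (U) => //= s U' IH /andP[hs /IH {}IH].
  by rewrite hs /= IH; case: s hs => //= x s _; rewrite take0.
(* Invariant of the outer fold: after the columns up to [c], the rows are those of [U] cut to [c.+1]
   cells. *)
suff fold k c : foldl (fun U' c => foldl (place c) U' (column T c)) (map (take c.+1) U)
    (iota c.+1 k) = map (take (c.+1 + k)) U.
  rewrite fold -[RHS]map_id; apply/eq_in_map => s sU; apply: take_oversize.
  (* A longer row would have a cell in a column whose index is at least the length of the bottom row
     of [T], where [T], hence also [U], has none. *)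
  rewrite leqNgt; apply/negP=> h.
  have := perm_mem (pT (1 + (size (row T 0)).-1)) (nth 0 s (1 + (size (row T 0)).-1)).
  rewrite hT; last lia.
  rewrite in_nil => /negP; apply; apply/mapP.
  by exists s => //; rewrite mem_filter h.
elim: k c => [|k IH] c /=; first by rewrite addn0.
by rewrite (foldl_place_column hU) ?IH ?addSnnS.
Qed.

Lemma phi_inv_Tab w : valid w -> phi_inv (Tab w) = Utab w.
Proof.
move=> vw; apply: (phi_inv_of_SYCT (Utab_SYCT vw)) => [|c|c|c].
- by rewrite mem_rev zero_notin_wshape.
- by rewrite column_Tab // pos_sorted.
- by rewrite column_Tab // column_Utab.
- move=> h; apply/size0nil; rewrite column_Tab // size_pos.
  by apply/eqP; rewrite -leqn0 leqNgt -in_diagram_Tab // /in_diagram -leqNgt.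
Qed.

Lemma Tab_vertex w : valid w -> QCS_vertex (rev (wshape w)) (Tab w).
Proof.
move=> vw; split; first by rewrite partition_rev; apply: Tab_SYT.
by rewrite phi_inv_Tab // shape_Utab.
Qed.

(** Together with [Tab_vertex], this identifies the vertices with the valid words of shape
    [rev alpha]; the reversal is due to [wshape] listing the top row first. *)
Lemma vertex_is_Tab alpha T : is_composition alpha -> QCS_vertex alpha T ->
  exists w, [/\ valid w, wshape w = rev alpha & T = Tab w].
Proof.
move=> al0 [hT hs]; have [w [vw _ e]] := SYT_is_Tab al0 hT.
by exists w; split=> //; rewrite -hs e phi_inv_Tab // shape_Utab revK.
Qed.

(** * Edges *)

Definition swap_next (i x : nat) : nat :=
  if x == i then i.+1 else if x == i.+1 then i else x.

Lemma t_opE i T : t_op i T = map_entries (swap_next i) T.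
Proof. by []. Qed.

Lemma swap_next_id i x : x < i -> swap_next i x = x.
Proof. by rewrite /swap_next => h; rewrite !ifF //; apply/eqP; lia. Qed.

Lemma swap_next_gt i x : i.+1 < x -> swap_next i x = x.
Proof. by rewrite /swap_next => h; rewrite !ifF //; apply/eqP; lia. Qed.

Lemma swap_nextK i : involutive (swap_next i).
Proof. by rewrite /swap_next => x; do !case: eqP; lia. Qed.

Lemma swap_next_inj i : injective (swap_next i).
Proof. exact: inv_inj (@swap_nextK i). Qed.

Lemma swap_next_l i : swap_next i i = i.+1.
Proof. by rewrite /swap_next eqxx. Qed.

Lemma swap_next_r i : swap_next i i.+1 = i.
Proof. by rewrite -{1}(swap_next_l i) swap_nextK. Qed.

(** The two letters belong to the entries [(size u).+1] and [(size u).+2]. Lying in different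
    columns, these can be exchanged without disturbing the order within any column. *)
Lemma pos_swap v u a b c : a != b ->
  pos c (v ++ b :: a :: u) = map (swap_next (size u).+1) (pos c (v ++ a :: b :: u)).
Proof.
move=> ab; elim: v => [|d v IH] /=; last first.
  case: ifP => _; rewrite ?IH // map_rcons; congr rcons.
  by rewrite swap_next_gt !size_cat //=; lia.
have hu : map (swap_next (size u).+1) (pos c u) = pos c u.
  by apply: map_id_in => x /pos_bound /andP[_ hx]; rewrite swap_next_id.
case: (eqVneq a c) ab => [->|_]; case: (eqVneq b c) => _; rewrite ?eqxx // => _;
  by rewrite ?map_rcons hu ?swap_next_l ?swap_next_r.
Qed.

Lemma shape_map_entries f T : shape (map_entries f T) = shape T.
Proof. by rewrite /shape /map_entries -map_comp; apply: eq_map => s /=; rewrite size_map. Qed.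

Lemma row_map_entries f T r : row (map_entries f T) r = map f (row T r).
Proof.
rewrite /row /map_entries; have [h|h] := ltnP r (size T); first by rewrite (nth_map [::]).
by rewrite !nth_default ?size_map.
Qed.

Lemma row_of_map_entries f T x :
  injective f -> row_of (map_entries f T) (f x) = row_of T x.
Proof.
move=> hf; rewrite /row_of /map_entries find_map; apply: eq_find => s /=.
by rewrite mem_map.
Qed.

Lemma Tab_swap v u a b : a != b ->
  valid (v ++ a :: b :: u) -> valid (v ++ b :: a :: u) ->
  wshape (v ++ a :: b :: u) = wshape (v ++ b :: a :: u) ->
  Tab (v ++ b :: a :: u) = t_op (size u).+1 (Tab (v ++ a :: b :: u)).
Proof.
move=> ab vw vw' eqs; rewrite t_opE; apply: tableau_ext => [|r c hd].
  by rewrite shape_map_entries !shape_Tab eqs.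
have hd' : in_diagram (Tab (v ++ a :: b :: u)) r c.
  by move: hd; rewrite /in_diagram !size_row_Tab eqs.
rewrite entry_Tab // pos_swap // /entry row_map_entries.
rewrite (nth_map 0) ?size_pos -?in_diagram_Tab // (nth_map 0) //.
by rewrite -entry_Tab.
Qed.

(* x precedes y in the row reading word, where g is the row index. *)
Definition reads_before (g : nat -> nat) (x y : nat) : bool :=
  (g y < g x) || ((g x == g y) && (x < y)).

Lemma reads_before_trans g : transitive (reads_before g).
Proof. by rewrite /reads_before => y x z; lia. Qed.

Lemma reads_before_irr g : irreflexive (reads_before g).
Proof. by rewrite /reads_before => x; lia. Qed.

Lemma row_word_sorted g T :
  (forall r x, x \in row T r -> g x = r) -> rows_increase T ->
  sorted (reads_before g) (row_word T).
Proof.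
rewrite (sorted_pairwise (@reads_before_trans g)) /rows_increase /row_word /row.
elim/last_ind: T => // T s IH hg; rewrite all_rcons => /andP[hs hT].
have gs x : x \in s -> g x = size T.
  by move=> hx; apply: hg; rewrite nth_rcons ltnn eqxx.
have gT r x : x \in nth [::] T r -> r < size T /\ g x = r.
  have [h|h] := ltnP r (size T); last by rewrite nth_default.
  by move=> hx; split=> //; apply: hg; rewrite nth_rcons h.
rewrite rev_rcons /= pairwise_cat; apply/and3P; split.
- apply/allrelP=> x y hx /flattenP[t]; rewrite mem_rev => /(nthP [::])[r hr <-] hy.
  by have [h1 h2] := gT r y hy; rewrite /reads_before (gs x hx) h2 h1.
- rewrite (sorted_pairwise ltn_trans) in hs; apply: (sub_in_pairwise (P := mem s)) (allss s) hs.
  by move=> x y hx hy /=; rewrite /reads_before !gs // eqxx => ->; rewrite orbT.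
- by apply: IH => // r x hx; case: (gT r x hx).
Qed.

Lemma row_in_diagram (T : tableau) r x : x \in row T r ->
  exists2 c, in_diagram T r c & entry T r c = x.
Proof. by move=> /(nthP 0)[c hc e]; exists c. Qed.

(** [reads_before] is a strict order, so a list sorted for it is determined by its members; it
    suffices to compare the rows of three entries. *)
Lemma restrict_row_word w i z : valid w -> 0 < i -> i + 2 <= size w ->
  z =i [:: i; i.+1; i.+2] -> sorted (reads_before (row_of (Tab w))) z ->
  restrict (row_word (Tab w)) i (i + 2) = z.
Proof.
move=> vw hi hn ez sz; have [[_ hpm] hrow _] := Tab_SYT vw.
have uT : uniq (flatten (Tab w)) by rewrite (perm_uniq hpm) iota_uniq.
apply: (irr_sorted_eq (@reads_before_trans (row_of (Tab w))) (@reads_before_irr _)) => //.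
  apply: sorted_filter; first exact: reads_before_trans.
  apply: row_word_sorted => // r x /row_in_diagram[c hc <-].
  by have [] := row_col_of_entry uT hc.
move=> x; rewrite ez mem_filter !inE.
have -> : (x \in row_word (Tab w)) = (0 < x <= size w).
  have -> : (x \in row_word (Tab w)) = (x \in flatten (Tab w)).
    by apply: perm_mem; apply: perm_flatten; rewrite perm_rev.
  by rewrite (perm_mem hpm) mem_iota sumn_partition sumn_wshape //; lia.
by apply/idP/idP; lia.
Qed.

Lemma row_of_Tab v u c : valid (v ++ c :: u) ->
  row_of (Tab (v ++ c :: u)) (size u).+1 = count_mem c u.
Proof.
move=> vw; have [[_ hpm] _ _] := Tab_SYT vw.
have uT : uniq (flatten (Tab (v ++ c :: u))) by rewrite (perm_uniq hpm) iota_uniq.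
have hd : in_diagram (Tab (v ++ c :: u)) (count_mem c u) c.
  by rewrite in_diagram_Tab // count_cat /= eqxx; lia.
have [h _] := row_col_of_entry uT hd.
by rewrite -[RHS]h entry_Tab // nth_pos.
Qed.

(** For [m = 1] the Dyck action merely exchanges [k] and [k.+1], and the two reading words are those
    whose insertion tableau has shape [(2, 1)] and in which [i] precedes [i.+1]. *)
Lemma CS_edge_elementary T i k z : 0 < i -> i + 2 <= sumn (shape T) ->
  restrict (row_word T) i (i + 2) = z ->
  (z = [:: i.+2; i; i.+1] /\ k = i.+1) \/ (z = [:: i; i.+2; i.+1] /\ k = i) ->
  CS_edge T (t_op k T).
Proof.
move=> hi hn hz hk; exists i, 1.
have hz1 : restrict (row_word T) i (i + 1) = [:: i; i.+1].
  have -> : restrict (row_word T) i (i + 1) = [seq x <- z | x <= i.+1].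
    rewrite -hz /restrict -filter_predI; apply: eq_filter => x /=.
    by apply/idP/idP; lia.
  by case: hk => -[-> _] /=; rewrite leqnn leqnSn ltnn.
have lt2 : i < i.+2 by lia.
have nlt1 : (i.+1 < i) = false by apply/negbTE; lia.
have nlt2 : (i.+2 < i) = false by apply/negbTE; lia.
split.
  split=> //; rewrite -/2.
    rewrite hz; case: hk => -[-> _]; rewrite /rsk_tableau /=.
      by rewrite lt2 /= nlt1.
    by rewrite nlt2 /= nlt1 /= ltnSn.
  by rewrite hz1 /rsk_tableau /= nlt1.
rewrite /dyck_act.
(* Only [i.+2] is an open bracket. It is paired with the closed bracket right after it, which leaves
   [i.+1] unpaired in the first case and [i] in the second. *)
have -> : dyck_letter T i 1 = k.
  rewrite /dyck_letter -/2 hz; case: hk => -[-> ->] /=; rewrite addn1.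
    by rewrite ltnSn ltnNge leqnSn ltnn.
  by rewrite ltnNge leqnSn.
apply: eq_map => s; apply: eq_map => x; rewrite addn1.
case: eqP => // ne; case: eqP => [->|ne'].
  by rewrite ltnSn.
by rewrite ifF //; apply/negbTE; lia.
Qed.

(** Neither extension creates or destroys a row of the length sought by the other, so the chosen
    rows do not depend on the order. *)
Lemma append_to_comm a b x y V : a != b -> a.+1 != b -> b.+1 != a ->
  append_to b y (append_to a x V) = append_to a x (append_to b y V).
Proof.
move=> h1 h2 h3; elim: V => //= s V IH.
have [ea|na] := eqVneq (size s) a; have [eb|nb] := eqVneq (size s) b => /=.
- by rewrite -ea -eb eqxx in h1.
- by rewrite size_rcons ea (negPf h2) eqxx.
- by rewrite size_rcons eb (negPf h3) eqxx.
- by rewrite (negPf na) (negPf nb) IH.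
Qed.

Lemma add_entry_comm a b x y V : (a.+1 < b) || (b.+1 < a) ->
  add_entry b y (add_entry a x V) = add_entry a x (add_entry b y V).
Proof.
case: a b => [|a] [|b] //= h.
- by rewrite ifF //; apply/eqP; lia.
- by rewrite ifF //; apply/eqP; lia.
- by apply: append_to_comm; lia.
Qed.

Lemma map_add_entry f c x V :
  map_entries f (add_entry c x V) = add_entry c (f x) (map_entries f V).
Proof.
case: c => // c /=; elim: V => //= s V IH; rewrite size_map -IH.
by case: ifP; rewrite /= ?map_rcons.
Qed.

Lemma Utop_swap v u a b : (a.+1 < b) || (b.+1 < a) -> valid u ->
  Utop (v ++ b :: a :: u) = map_entries (swap_next (size u).+1) (Utop (v ++ a :: b :: u)).
Proof.
move=> far vu; elim: v => [|d v IH] /=; last first.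
  rewrite IH map_add_entry swap_next_gt !size_cat //=; lia.
rewrite add_entry_comm // !map_add_entry swap_next_l swap_next_r; congr (add_entry _ _ (add_entry _ _ _)).
rewrite -[LHS]map_id; apply/eq_in_map => s hs; rewrite -[LHS]map_id.
apply/eq_in_map => x hx; rewrite swap_next_id //.
have : x \in flatten (Utop u) by apply/flattenP; exists s.
by rewrite (perm_mem (flatten_Utop vu)) mem_iota; lia.
Qed.

Lemma Utab_swap v u a b : (a.+1 < b) || (b.+1 < a) -> valid u ->
  Utab (v ++ b :: a :: u) = t_op (size u).+1 (Utab (v ++ a :: b :: u)).
Proof. by move=> far vu; rewrite /Utab Utop_swap // /t_op /map_entries map_rev. Qed.

Lemma col_of_Utab v u c : valid (v ++ c :: u) ->
  exists r, [/\ in_diagram (Utab (v ++ c :: u)) r c,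
    entry (Utab (v ++ c :: u)) r c = (size u).+1,
    row_of (Utab (v ++ c :: u)) (size u).+1 = r
  & col_of (Utab (v ++ c :: u)) (size u).+1 = c].
Proof.
move=> vw; have : (size u).+1 \in column (Utab (v ++ c :: u)) c.
  rewrite (perm_mem (column_Utab c vw)) mem_pos size_cat /=.
  rewrite (_ : size v + _ - _ = size v); last lia.
  by rewrite nth_cat ltnn subnn eqxx andbT; lia.
case/mem_column=> r hr er; exists r.
have uU : uniq (flatten (Utab (v ++ c :: u))).
  by rewrite (perm_uniq (flatten_Utab vw)) iota_uniq.
by have [h1 h2] := row_col_of_entry uU hr; rewrite er in h1 h2.
Qed.

Lemma t_edge_Tab v u a b : (a.+1 < b) || (b.+1 < a) ->
  valid (v ++ b :: a :: u) -> valid (v ++ a :: b :: u) ->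
  wshape (v ++ b :: a :: u) = wshape (v ++ a :: b :: u) ->
  row_of (Utab (v ++ b :: a :: u)) (size u).+1
    < row_of (Utab (v ++ b :: a :: u)) (size u).+2 ->
  t_edge (rev (wshape (v ++ b :: a :: u)))
    (Tab (v ++ b :: a :: u)) (Tab (v ++ a :: b :: u)).
Proof.
move=> far vw vw' eqs hrow.
split; [exact: Tab_vertex|rewrite eqs; exact: Tab_vertex|].
exists (size u).+1; rewrite !phi_inv_Tab // [in RHS]t_opE.
have vu : valid u by have := @valid_catr (v ++ [:: b; a]) u; rewrite -catA; apply.
split; last by rewrite -t_opE -Utab_swap // orbC.
(* The word is split before [a] instead of [b] to locate the smaller of the two entries. *)
have [r1 [_ _ _ c1]] := @col_of_Utab (rcons v b) u a (ltac:(by rewrite cat_rcons)).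
have [r2 [_ _ _ c2]] := @col_of_Utab v (a :: u) b vw.
rewrite cat_rcons in c1; rewrite [size (a :: u)]/= in c2.
have mem x : (x \in flatten (Utab (v ++ b :: a :: u))) = (0 < x <= size u + size v + 2).
  by rewrite (perm_mem (flatten_Utab vw)) mem_iota size_cat /=; apply/idP/idP; lia.
split=> //.
- by rewrite shape_Utab; apply: Utab_SYCT.
- by rewrite mem; lia.
- by rewrite mem; lia.
- by rewrite c1 c2; case/orP: far; [left|right].
Qed.

(** Along a row, [k] steps to the right raise the entry by at least [k], so consecutive numbers in
    one row would lie in adjacent columns. *)
Lemma row_of_neq_Utab v u a b : (a.+1 < b) || (b.+1 < a) ->
  valid (v ++ b :: a :: u) ->
  row_of (Utab (v ++ b :: a :: u)) (size u).+1
    != row_of (Utab (v ++ b :: a :: u)) (size u).+2.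
Proof.
move=> far vw.
have [r1 [d1 e1 h1 _]] := @col_of_Utab (rcons v b) u a (ltac:(by rewrite cat_rcons)).
have [r2 [d2 e2 h2 _]] := @col_of_Utab v (a :: u) b vw.
rewrite cat_rcons in d1 e1 h1; rewrite [size (a :: u)]/= in e2 h2.
rewrite h1 h2; apply/eqP=> e; rewrite -e in d2 e2.
have inc c : in_diagram (Utab (v ++ b :: a :: u)) r1 c.+1 ->
    entry (Utab (v ++ b :: a :: u)) r1 c < entry (Utab (v ++ b :: a :: u)) r1 c.+1.
  exact: SYCT_row_lt (Utab_SYCT vw).
have mono c k : in_diagram (Utab (v ++ b :: a :: u)) r1 (c + k) ->
    entry (Utab (v ++ b :: a :: u)) r1 c + k <= entry (Utab (v ++ b :: a :: u)) r1 (c + k).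
  elim: k => [|k IH]; first by rewrite !addn0.
  rewrite !addnS => hd; apply: leq_trans (inc _ hd); rewrite ltnS IH //.
  by apply: ltnW hd.
case/orP: far => far.
  by have := mono a (b - a); rewrite subnKC; last lia; rewrite e1 e2 => /(_ d2); lia.
by have := mono b (a - b); rewrite subnKC; last lia; rewrite e1 e2 => /(_ d1); lia.
Qed.

Lemma word_edge_Tab w w' : word_edge w w' ->
  clos_refl_sym_trans tableau (QCS_plus_edge (rev (wshape w))) (Tab w) (Tab w').
Proof.
case=> vw vw' eqs mv; case: mv vw vw' eqs => [v u a b far|v u a|v u a] vw vw' eqs.
(* The relative height of the two entries decides which of the two tableaux is the source of the
   [t_i] edge. *)
- have := row_of_neq_Utab far vw; rewrite neq_ltn => /orP[lt|gt].
    by apply: rst_step; right; apply: t_edge_Tab.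
  have far' : (b.+1 < a) || (a.+1 < b) by rewrite orbC.
  have vu : valid u by have := @valid_catr (v ++ [:: b; a]) u; rewrite -catA; apply.
  apply: rst_sym; apply: rst_step; right; rewrite eqs; apply: t_edge_Tab => //.
  (* Exchanging the two values exchanges their rows, so the reverse move satisfies the height
     condition. *)
  rewrite (Utab_swap v far' vu) t_opE.
  have rl := row_of_map_entries (Utab (v ++ b :: a :: u)) _ (@swap_next_inj (size u).+1).
  by have := rl (size u).+1; have := rl (size u).+2; rewrite swap_next_l swap_next_r => -> ->.
- apply: rst_step; left; split; [exact: Tab_vertex|rewrite eqs; exact: Tab_vertex|].
  have -> : Tab (v ++ [:: a.+1, a, a & u])
      = t_op (size u).+2 (Tab (v ++ [:: a, a.+1, a & u])).
    by apply: (Tab_swap (u := a :: u)) => //; apply/eqP; lia.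
  have hn : (size u).+1 + 2 <= size (v ++ a :: a.+1 :: a :: u) by rewrite size_cat /=; lia.
  set i := (size u).+1 in hn *.
  apply: (@CS_edge_elementary _ i _ [:: i.+2; i; i.+1]); rewrite /i //.
  + by rewrite shape_Tab sumn_partition sumn_wshape.
  (* In column [a], [i.+2] lies one row above [i]. By validity [i.+1], in column [a.+1], is not
     above [i], so the reading order is [i.+2], [i], [i.+1]. *)
  + apply: restrict_row_word => // [x|]; first by rewrite !inE; apply/idP/idP; lia.
    have r1 := @row_of_Tab (v ++ [:: a; a.+1]) u a; rewrite -catA /= in r1.
    have r2 := @row_of_Tab (v ++ [:: a]) (a :: u) a.+1; rewrite -catA /= in r2.
    have r3 := @row_of_Tab v (a.+1 :: a :: u) a vw.
    have := @count_next (a.+1 :: a :: u) a.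
    have := @valid_catr (v ++ [:: a]) (a.+1 :: a :: u); rewrite -catA => /(_ vw) vs /(_ vs).
    rewrite /= /reads_before r1 // r2 // r3 /=; lia.
  + by left.
- apply: rst_step; left; split; [exact: Tab_vertex|rewrite eqs; exact: Tab_vertex|].
  have -> : Tab (v ++ [:: a.+1, a, a.+1 & u])
      = t_op (size u).+1 (Tab (v ++ [:: a.+1, a.+1, a & u])).
    rewrite -!(cat_rcons a.+1 v); apply: Tab_swap; rewrite ?cat_rcons //; apply/eqP; lia.
  have hn : (size u).+1 + 2 <= size (v ++ a.+1 :: a.+1 :: a :: u) by rewrite size_cat /=; lia.
  set i := (size u).+1 in hn *.
  apply: (@CS_edge_elementary _ i _ [:: i; i.+2; i.+1]); rewrite /i //.
  + by rewrite shape_Tab sumn_partition sumn_wshape.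
  (* In column [a.+1], [i.+2] lies one row above [i.+1]. Validity of the word up to [i.+2] keeps it
     no higher than [i], so the reading order is [i], [i.+2], [i.+1]. *)
  + apply: restrict_row_word => // [x|]; first by rewrite !inE; apply/idP/idP; lia.
    have r1 := @row_of_Tab (v ++ [:: a.+1; a.+1]) u a; rewrite -catA /= in r1.
    have r2 := @row_of_Tab (v ++ [:: a.+1]) (a :: u) a.+1; rewrite -catA /= in r2.
    have r3 := @row_of_Tab v (a.+1 :: a :: u) a.+1 vw.
    have := @count_next (a.+1 :: a.+1 :: a :: u) a.
    have := @valid_catr v (a.+1 :: a.+1 :: a :: u) vw => vs /(_ vs).
    rewrite /= /reads_before r1 // r2 // r3 /=; lia.
  + by right.
Qed.

Lemma word_conn_Tab w w' : word_conn w w' ->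
  clos_refl_sym_trans tableau (QCS_plus_edge (rev (wshape w))) (Tab w) (Tab w').
Proof.
elim=> {w w'} [w w' /word_edge_Tab //|w|w w' h IH|w1 w2 w3 h1 IH1 _ IH2].
- exact: rst_refl.
- by rewrite -(word_conn_shape h); apply: rst_sym.
- by apply: rst_trans IH1 _; rewrite (word_conn_shape h1).
Qed.

Unset Implicit Arguments.

Theorem theorem4p21 (alpha : seq nat) (halpha : is_composition alpha) :
  connected_graph (QCS_vertex alpha) (QCS_plus_edge alpha).
Proof.
split.
  have [w vw hw] := @valid_word_exists (rev alpha) (ltac:(by rewrite mem_rev)).
  by exists (Tab w); rewrite -[alpha]revK -hw; apply: Tab_vertex.
move=> T T' hT hT'.
have [w [vw hw ->]] := vertex_is_Tab halpha hT.
have [w' [vw' hw' ->]] := vertex_is_Tab halpha hT'.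
rewrite -[alpha]revK -hw; apply: word_conn_Tab.
by apply: word_connected => //; rewrite hw hw'.
Qed.
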